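(* The functor $\ell^2 \colon \mathbf{PInj} \to \mathbf{Hilb}$ has no adjoints, i.e. it has neither a left adjoint nor a right adjoint.
   Context: $\mathbf{Hilb}$ is the category whose objects are complex Hilbert spaces and whose morphisms are continuous linear functions. $\mathbf{PInj}$ is the category whose objects are sets and whose morphisms $X \to Y$ are partial injections, i.e. partial functions that are injective on their domain of definition, composed as relations. The functor $\ell^2 \colon \mathbf{PInj} \to \mathbf{Hilb}$ sends a set $X$ to $\ell^2(X) = \{\varphi \colon X \to \mathbb{C} \mid \sum_{x\in X} |\varphi(x)|^2 < \infty\}$ with inner product $\langle \varphi | \psi\rangle = \sum_{x \in X} \overline{\varphi(x)}\psi(x)$, and sends a partial injection $f \colon X \to Y$ to the linear map $\ell^2 f \colon \ell^2(X) \to \ell^2(Y)$ with $(\ell^2 f)(\varphi)(y) = \varphi(x)$ if there is a (necessarily unique) $x$ in the domain of definition of $f$ with $f(x) = y$, and $(\ell^2 f)(\varphi)(y) = 0$ otherwise. *)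

(* Defs.v *)
From HB Require Import structures.
From mathcomp Require Import all_boot all_order all_algebra finmap sesquilinear.
From mathcomp Require Import all_classical all_reals.
From mathcomp Require Import ereal topology normedtype esum.
From mathcomp Require Import summability.
From mathcomp Require Import complex.
From mathcomp Require Import ring lra.
Set Implicit Arguments.
Unset Strict Implicit.
Unset Printing Implicit Defensive.
Import Order.TTheory GRing.Theory Num.Theory.
Import numFieldNormedType.Exports ComplexField.Normc.
Local Open Scope classical_set_scope.
Local Open Scope ring_scope.
Local Open Scope complex_scope.

#[local] Existing Instance totally_filter.

Section RealFamilies.
Context {R : realType} {T : choiceType}.
Implicit Types h : T -> R.
Local Notation S h := (\esum_(x in [set: T]) (h x)%:E)%E.

Lemma esum_leP h (M : R) : (forall x, 0 <= h x) ->
  (S h <= M%:E)%E <->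
  (forall s : seq T, uniq s -> \sum_(i <- s) h i <= M).
Proof.
move=> h0; split=> [le_hM s us | le_hM].
  rewrite -lee_fin; apply: le_trans le_hM; apply: esum_ge.
  exists [set` s]; first by split.
  by rewrite -fsbig_seq// sumEFin.
apply: ge_ereal_sup => _ [A [finA _] <-].
rewrite fsbig_finite// sumEFin lee_fin; apply: le_hM; exact: fset_uniq.
Qed.

Lemma partial_sumE (V : zmodType) (f : T -> V) (A : {fset T}) :
  partial_sum f A = \sum_(i <- A) f i.
Proof. by rewrite /partial_sum big_seq_fsetE. Qed.

Lemma cvg_partial_sum_ge0 h : (forall x, 0 <= h x) -> (S h < +oo)%E ->
  partial_sum h @ totally --> fine (S h).
Proof.
move=> h0 hoo; have S0 : (0 <= S h)%E by apply: esum_ge0 => x _; rewrite lee_fin.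
have Sfin : (S h \is a fin_num) by rewrite ge0_fin_numE.
apply/cvgrPdist_le => /= e e0.
have : ((fine (S h) - e)%:E < S h)%E.
  by rewrite -[ltRHS]fineK// lte_fin ltrBlDr ltrDl.
move=> /ereal_sup_gt[_ [A [finA _] <-]].
rewrite fsbig_finite// sumEFin lte_fin => lt_A.
exists (fset_set A) => //= B /= AB; rewrite partial_sumE.
have le_S : \sum_(i <- B) h i <= fine (S h).
  by apply: (esum_leP (fine (S h)) h0).1 => //; rewrite fineK.
rewrite ger0_norm ?subr_ge0// lerBlDl -lerBlDr.
apply: le_trans (ltW lt_A) _.
rewrite (big_fsetID _ (mem (fset_set A)) B)/=.
have -> : [fset x in B | x \in fset_set A]%fset = fset_set A.
  by apply/fsetP => x; rewrite !inE andbC andb_idr// => /(fsubsetP AB).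
by rewrite lerDl sumr_ge0.
Qed.

Lemma is_cvg_partial_sum (g : T -> R) h : (forall x, `|g x| <= h x) -> (S h < +oo)%E ->
  cvg ((partial_sum g : {fset T} -> R) @ totally).
Proof.
move=> gh hoo.
have h0 x : 0 <= h x by apply: le_trans (gh x).
have gh0 x : 0 <= g x + h x by rewrite -lerBlDr sub0r lerNl; apply: le_trans (gh x); rewrite -normrN ler_norm.
have ghoo : (S (fun x => (g x + h x)%R) < +oo)%E.
  apply: (@le_lt_trans _ _ (S (fun x => h x + h x)%R)).
    by apply: le_esum => x _; rewrite lee_fin lerD2r; apply: le_trans (gh x); rewrite ler_norm.
  under eq_esum do rewrite EFinD.
  by rewrite esumD ?lte_add_pinfty// => x _; rewrite lee_fin.
have -> : (partial_sum g : {fset T} -> R) =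
    (partial_sum (fun x => g x + h x) : {fset T} -> R) - partial_sum h.
  apply/funext => A; rewrite /= !fctE !partial_sumE -sumrB.
  by apply: eq_bigr => i _; rewrite addrK.
apply: is_cvgB; apply: cvgP; exact: cvg_partial_sum_ge0.
Qed.

End RealFamilies.

Section ComplexFamilies.
Context {R : realType} {T : choiceType}.
Implicit Types (h : T -> R) (a : T -> R[i]^o).
Local Notation S h := (\esum_(x in [set: T]) (h x)%:E)%E.

Lemma norm_normc (z : R[i]) : `|z| = (normc z)%:C.
Proof. by case: z => x y; rewrite normc_def. Qed.

Lemma le_Re_normc (z : R[i]) : `|complex.Re z| <= normc z.
Proof. by rewrite -lecR -norm_normc normc_ge_Re. Qed.

Lemma le_Im_normc (z : R[i]) : `|complex.Im z| <= normc z.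
Proof.
by case: z => x y /=; rewrite -sqrtr_sqr ler_wsqrtr// lerDr sqr_ge0.
Qed.

Lemma cvg_realC (U : Type) (F : set_system U) (FF : Filter F) (f : U -> R) (l : R) :
  f @ F --> l -> (fun u => (f u)%:C : R[i]^o) @ F --> (l%:C : R[i]^o).
Proof.
move=> /cvgrPdist_le fl; apply/cvgrPdist_le => /= -[e e'].
rewrite ltcE/= => /andP[/eqP-> /fl]; apply: filterS => u.
by rewrite -rmorphB norm_normc/= expr0n/= addr0 sqrtr_sqr lecR.
Qed.

Lemma cvg_complexE (U : Type) (F : set_system U) (FF : Filter F)
    (f : U -> R[i]) (x y : R) :
  (fun u => complex.Re (f u)) @ F --> x ->
  (fun u => complex.Im (f u)) @ F --> y ->
  (f : U -> R[i]^o) @ F --> (x +i* y : R[i]^o).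
Proof.
move=> fx fy.
have -> : (x +i* y : R[i]^o) = (x%:C : R[i]^o) + ('i : R[i]) *: (y%:C : R[i]^o).
  by rewrite [LHS]complexE.
have -> : (f : U -> R[i]^o) = (fun u => (complex.Re (f u))%:C : R[i]^o)
     + (('i : R[i]) \*: (fun u => (complex.Im (f u))%:C : R[i]^o)).
  by apply/funext => u; rewrite [LHS]complexE.
by apply: cvgD; [exact: cvg_realC | apply: cvgZl_tmp; exact: cvg_realC].
Qed.

Lemma cvg_complex (U : Type) (F : set_system U) (FF : Filter F)
    (f : U -> R[i]) :
  cvg ((fun u => complex.Re (f u)) @ F) ->
  cvg ((fun u => complex.Im (f u)) @ F) ->
  cvg ((f : U -> R[i]^o) @ F).
Proof.
move=> /cvg_ex[x fx] /cvg_ex[y fy]; apply/cvg_ex; exists (x +i* y).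
exact: cvg_complexE.
Qed.


Lemma Re_sum (s : seq T) (a : T -> R[i]) :
  complex.Re (\sum_(i <- s) a i) = \sum_(i <- s) complex.Re (a i).
Proof. exact: (raddf_sum (@complex.Re R : Rcomplex R -> R)). Qed.

Lemma Im_sum (s : seq T) (a : T -> R[i]) :
  complex.Im (\sum_(i <- s) a i) = \sum_(i <- s) complex.Im (a i).
Proof. exact: (raddf_sum (@complex.Im R : Rcomplex R -> R)). Qed.

(* Unordered sum: the limit of the finite partial sums along the directed set
   of finite subsets of T. *)
Definition usum (a : T -> R[i]) : R[i] := summability.sum (a : T -> R[i]^o).

Definition usummable (a : T -> R[i]) :=
  cvg (partial_sum (a : T -> R[i]^o) @ totally).

Lemma usummable_le (a : T -> R[i]) h :
  (forall x, normc (a x) <= h x) -> (S h < +oo)%E -> usummable a.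
Proof.
move=> ah hoo; apply: cvg_complex.
  have -> : (fun A => complex.Re (partial_sum (a : T -> R[i]^o) A)) =
      (partial_sum (fun x => complex.Re (a x)) : {fset T} -> R).
    by apply/funext => A; rewrite !partial_sumE Re_sum.
  apply: is_cvg_partial_sum hoo => x.
  by apply: le_trans (ah x); exact: le_Re_normc.
have -> : (fun A => complex.Im (partial_sum (a : T -> R[i]^o) A)) =
    (partial_sum (fun x => complex.Im (a x)) : {fset T} -> R).
  by apply/funext => A; rewrite !partial_sumE Im_sum.
apply: is_cvg_partial_sum hoo => x.
by apply: le_trans (ah x); exact: le_Im_normc.
Qed.

Lemma usumE (a : T -> R[i]) (l : R[i]^o) :
  partial_sum (a : T -> R[i]^o) @ totally --> l -> usum a = l.
Proof. by move=> al; rewrite /usum /summability.sum; apply: (@cvg_lim (R[i]^o)) => //; exact: norm_hausdorff. Qed.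

Lemma usumP (a : T -> R[i]) : usummable a ->
  partial_sum (a : T -> R[i]^o) @ totally --> (usum a : R[i]^o).
Proof. by []. Qed.

Lemma usum_linear (k : R[i]) (a b : T -> R[i]) : usummable a -> usummable b ->
  usum (fun x => k * a x + b x) = k * usum a + usum b.
Proof.
move=> /usumP aP /usumP bP; apply: usumE.
have -> : partial_sum ((fun x => k * a x + b x) : T -> R[i]^o) =
    (fun A => (k *: (partial_sum (a : T -> R[i]^o) A : R[i]^o) +
               partial_sum (b : T -> R[i]^o) A)).
  apply/funext => A; rewrite !partial_sumE big_split /=.
  by rewrite -mulr_sumr.
apply: cvgD; last exact: bP.
apply: cvgZl_tmp; exact: aP.
Qed.

Lemma usum_realC h : (forall x, 0 <= h x) -> (S h < +oo)%E ->
  usum (fun x => (h x)%:C) = (fine (S h))%:C.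
Proof.
move=> h0 hoo; apply: usumE.
have -> : partial_sum ((fun x => (h x)%:C) : T -> R[i]^o) =
    (fun A => (partial_sum h A)%:C).
  by apply/funext => A; rewrite !partial_sumE rmorph_sum.
by apply: cvg_realC; exact: cvg_partial_sum_ge0.
Qed.

Lemma usum_conj (a : T -> R[i]) : usummable a ->
  usum (fun x => Num.conj (a x)) = Num.conj (usum a).
Proof.
move=> /usumP /cvgrPdist_le aP; apply: usumE; apply/cvgrPdist_le => e /aP.
apply: filterS => A; rewrite !partial_sumE /=.
have -> : \sum_(i <- A) ((Num.conj (a i)) : R[i]^o) = Num.conj (\sum_(i <- A) a i).
  by rewrite rmorph_sum.
by rewrite -[in X in _ -> X]rmorphB norm_conjC.
Qed.

End ComplexFamilies.

Section SquareSummable.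
Context {R : realType} {X : Type}.
Implicit Types phi psi : X -> R[i].

(* A set is an arbitrary type; {classic X} only provides the choice structure
   that the library requires of index types. *)
Definition sqnorm phi : \bar R :=
  (\esum_(x in [set: {classic X}]) (normc (phi x) ^+ 2)%:E)%E.

Definition square_summable : {pred X -> R[i]} :=
  [pred phi | (sqnorm phi < +oo)%E].

Lemma sqnorm_ge0 phi : (0 <= sqnorm phi)%E.
Proof. by apply: esum_ge0 => x _; rewrite lee_fin sqr_ge0. Qed.

Lemma normc_ge0 (z : R[i]) : 0 <= normc z.
Proof. by rewrite -ler0c -norm_normc. Qed.

Lemma esum_pZl (T : choiceType) (k : R) (h : T -> R) : 0 <= k ->
  (forall x, 0 <= h x) ->
  (\esum_(x in [set: T]) (k * h x)%:E = k%:E * \esum_(x in [set: T]) (h x)%:E)%E.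
Proof.
move=> k0 h0.
have le_esumZ (l : R) (g : T -> R) : 0 <= l -> (forall x, 0 <= g x) ->
  (\esum_(x in [set: T]) (l * g x)%:E <= l%:E * \esum_(x in [set: T]) (g x)%:E)%E.
  move=> l0 g0; apply: ge_ereal_sup => _ [A fA <-].
  rewrite fsbig_finite//=; last by case: fA.
  rewrite sumEFin -mulr_sumr EFinM lee_wpmul2l ?lee_fin//.
  apply: esum_ge; exists A => //; rewrite fsbig_finite ?sumEFin//.
  by case: fA.
move: k0; rewrite le_eqVlt => /predU1P[<-|k0].
  by rewrite mul0e esum1// => x _; rewrite mul0r.
apply/eqP; rewrite eq_le le_esumZ ?(ltW k0)//=.
have kV0 : 0 <= k^-1 by rewrite invr_ge0 ltW.
have kh0 x : 0 <= k * h x := mulr_ge0 (ltW k0) (h0 x).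
have := @lee_wpmul2l _ k%:E (ltW k0) _ _ (le_esumZ _ _ kV0 kh0).
rewrite muleA -EFinM divff ?gt_eqF// mul1e.
by under eq_esum do rewrite mulrA mulVf ?gt_eqF// mul1r.
Qed.

Lemma sqnormZ (k : R[i]) phi :
  sqnorm (k *: phi) = ((normc k ^+ 2)%:E * sqnorm phi)%E.
Proof.
rewrite /sqnorm -esum_pZl ?sqr_ge0//; last by move=> x; exact: sqr_ge0.
by apply: eq_esum => x _; rewrite normcM exprMn.
Qed.

Lemma normcD_sqr (t : R) (u v : R[i]) : 0 < t ->
  normc (u + v) ^+ 2 <= (1 + t) * normc u ^+ 2 + (1 + t^-1) * normc v ^+ 2.
Proof.
move=> t0; apply: (@le_trans _ _ ((normc u + normc v) ^+ 2)).
  have uv0 : 0 <= normc u + normc v by rewrite addr_ge0 ?normc_ge0.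
  by rewrite ler_pXn2r ?nnegrE ?normc_ge0//; exact: le_normcD.
rewrite -subr_ge0.
have -> : (1 + t) * normc u ^+ 2 + (1 + t^-1) * normc v ^+ 2 -
     (normc u + normc v) ^+ 2 = t^-1 * (t * normc u - normc v) ^+ 2.
  by field; rewrite gt_eqF.
by rewrite mulr_ge0 ?sqr_ge0// invr_ge0 ltW.
Qed.

Lemma sqnormD (t : R) phi psi : 0 < t ->
  (sqnorm (phi + psi)%R <=
    (1 + t)%:E * sqnorm phi + (1 + t^-1)%:E * sqnorm psi)%E.
Proof.
move=> t0.
have t1 : 0 <= 1 + t by rewrite addr_ge0// ltW.
have t2 : 0 <= 1 + t^-1 by rewrite addr_ge0// invr_ge0 ltW.
rewrite -!esum_pZl// ?sqr_ge0; [|by move=> x; exact: sqr_ge0..].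
rewrite -esumD; [|by move=> x _; rewrite lee_fin mulr_ge0 ?sqr_ge0..].
by apply: le_esum => x _; rewrite -EFinD lee_fin; exact: normcD_sqr.
Qed.

Lemma sqnorm_leP phi (M : R) : (sqnorm phi <= M%:E)%E <->
  (forall s : seq {classic X}, uniq s ->
     \sum_(x <- s) normc (phi x) ^+ 2 <= M).
Proof. by apply: esum_leP => x; exact: sqr_ge0. Qed.

Lemma square_summable_submod : submod_closed square_summable.
Proof.
split=> [|k phi psi].
  rewrite inE /sqnorm esum1// => x _.
  by rewrite normc0 expr0n.
rewrite !inE => phioo psioo; apply: le_lt_trans (sqnormD _ _ ltr01) _.
have mul_oo (r : R) (y : \bar R) : 0 <= r -> (y < +oo -> r%:E * y < +oo)%E.
  by move=> r0; apply: lte_mul_pinfty; rewrite ?lee_fin.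
rewrite sqnormZ lte_add_pinfty// !mul_oo// ?sqr_ge0 ?addr_ge0//.
Qed.

HB.instance Definition _ := GRing.isSubmodClosed.Build R[i] (X -> R[i])
  square_summable square_summable_submod.

End SquareSummable.

Record l2 (R : realType) (X : Type) : Type := L2 {
  l2_fun :> X -> R[i] ;
  l2_square_summable : l2_fun \in square_summable }.

HB.instance Definition _ (R : realType) (X : Type) :=
  [isSub for @l2_fun R X].
HB.instance Definition _ (R : realType) (X : Type) :=
  [Choice of l2 R X by <:].
HB.instance Definition _ (R : realType) (X : Type) :=
  [SubChoice_isSubLmodule of l2 R X by <:].

Section L2Norm.
Context {R : realType} {X : Type}.
Implicit Types phi psi : l2 R X.

Lemma l2P phi psi : phi =1 psi -> phi = psi.
Proof. by move=> e; apply/val_inj/funext. Qed.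

Lemma l2DE phi psi x : (phi + psi) x = phi x + psi x. Proof. by []. Qed.
Lemma l2NE phi x : (- phi) x = - phi x. Proof. by []. Qed.
Lemma l2ZE (k : R[i]) phi x : (k *: phi) x = k * phi x. Proof. by []. Qed.
Lemma l20E x : (0 : l2 R X) x = 0. Proof. by []. Qed.

Definition rnorm phi : R := Num.sqrt (fine (sqnorm phi)).

Lemma rnorm_ge0 phi : 0 <= rnorm phi. Proof. exact: sqrtr_ge0. Qed.

Lemma sqr_rnormE phi : sqnorm phi = (rnorm phi ^+ 2)%:E.
Proof.
have phioo := l2_square_summable phi; rewrite inE in phioo.
by rewrite sqr_sqrtr ?fine_ge0 ?sqnorm_ge0// fineK// ge0_fin_numE// sqnorm_ge0.
Qed.

Lemma rnorm_leP phi (M : R) : 0 <= M ->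
  (rnorm phi <= M <-> (sqnorm phi <= (M ^+ 2)%:E)%E).
Proof.
by move=> M0; rewrite sqr_rnormE lee_fin ler_pXn2r// nnegrE// rnorm_ge0.
Qed.

Lemma rnorm_ge_seq phi (s : seq {classic X}) : uniq s ->
  \sum_(x <- s) normc (phi x) ^+ 2 <= rnorm phi ^+ 2.
Proof. by apply: (sqnorm_leP _ _).1; rewrite sqr_rnormE. Qed.

Lemma normc_le_rnorm phi x : normc (phi x) <= rnorm phi.
Proof.
have := @rnorm_ge_seq phi [:: x : {classic X}] isT; rewrite big_seq1.
by rewrite ler_pXn2r// nnegrE ?normc_ge0 ?rnorm_ge0.
Qed.

Lemma rnorm0_eq0 phi : rnorm phi = 0 -> phi = 0.
Proof.
move=> phi0; apply: l2P => x; apply: eq0_normc; apply/eqP.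
by rewrite eq_le normc_ge0 -phi0 normc_le_rnorm.
Qed.

Lemma rnormZ (k : R[i]) phi : rnorm (k *: phi) = normc k * rnorm phi.
Proof.
rewrite {1}/rnorm [X in sqnorm X](_ : _ = k *: (phi : X -> R[i]))//.
rewrite sqnormZ sqr_rnormE -EFinM /= -exprMn sqrtr_sqr ger0_norm//.
by rewrite mulr_ge0 ?normc_ge0 ?rnorm_ge0.
Qed.

Lemma rnorm0 : rnorm (0 : l2 R X) = 0.
Proof. by rewrite -(scale0r (0 : l2 R X)) rnormZ normc0 mul0r. Qed.

Lemma ler_rnormD phi psi : rnorm (phi + psi) <= rnorm phi + rnorm psi.
Proof.
have [phi0|phi0] := eqVneq (rnorm phi) 0.
  by rewrite (rnorm0_eq0 phi0) add0r rnorm0 add0r.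
have [psi0|psi0] := eqVneq (rnorm psi) 0.
  by rewrite (rnorm0_eq0 psi0) addr0 rnorm0 addr0.
have {}phi0 : 0 < rnorm phi by rewrite lt0r phi0 rnorm_ge0.
have {}psi0 : 0 < rnorm psi by rewrite lt0r psi0 rnorm_ge0.
apply/rnorm_leP; first by rewrite addr_ge0 ?rnorm_ge0.
apply: le_trans (@sqnormD _ _ (rnorm psi / rnorm phi) phi psi _) _.
  by rewrite divr_gt0.
rewrite !sqr_rnormE -!EFinM -EFinD lee_fin le_eqVlt; apply/orP; left.
by apply/eqP; field; rewrite !gt_eqF.
Qed.

Definition l2_norm phi : R[i] := (rnorm phi)%:C.

Lemma ler_l2_normD phi psi : l2_norm (phi + psi) <= l2_norm phi + l2_norm psi.
Proof. by rewrite -rmorphD lecR ler_rnormD. Qed.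

Lemma l2_normZ (k : R[i]) phi : l2_norm (k *: phi) = `|k| * l2_norm phi.
Proof. by rewrite norm_normc -rmorphM /l2_norm rnormZ. Qed.

Lemma l2_norm0_eq0 phi : l2_norm phi = 0 -> phi = 0.
Proof. by move=> /complexI/rnorm0_eq0. Qed.

End L2Norm.

HB.instance Definition _ (R : realType) (X : Type) :=
  Lmodule_isNormed.Build R[i] (l2 R X)
    ler_l2_normD l2_normZ l2_norm0_eq0.

Section L2Complete.
Context {R : realType} {X : Type}.
Implicit Types phi psi : l2 R X.

Lemma l2_normE phi : `|phi| = (rnorm phi)%:C. Proof. by []. Qed.

Lemma l2_ballE phi psi (e : R) : ball phi (e%:C) psi = (rnorm (phi - psi) < e).
Proof. by rewrite -ball_normE /ball_/= l2_normE ltcR. Qed.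

Lemma cvg_coord (F : set_system (l2 R X)) (FF : ProperFilter F)
    (f : l2 R X -> R) : cauchy_ex F ->
  (forall phi psi, `|f phi - f psi| <= rnorm (phi - psi)) -> cvg (f @ F).
Proof.
move=> cF flip; apply/cauchy_cvgP/cauchy_exP => e e0.
have [|phi Fphi] := cF e%:C; first by rewrite ltcR.
exists (f phi).
change (F (f @^-1` ball (f phi) e)); apply: filterS Fphi => psi; rewrite l2_ballE => lt_e.
by rewrite /preimage/= -ball_normE /ball_/=; apply: le_lt_trans (flip _ _) lt_e.
Qed.

Lemma l2_complete (F : set_system (l2 R X)) :
  ProperFilter F -> cauchy F -> cvg F.
Proof.
move=> FF /cauchyP cF.
have ReF x : cvg ((fun phi : l2 R X => complex.Re (phi x)) @ F).
  apply: cvg_coord => // phi psi; apply: (le_trans _ (normc_le_rnorm _ x)).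
  apply: (le_trans _ (le_Re_normc _)); rewrite l2DE l2NE.
  by case: (phi x) (psi x) => [a b] [c d].
have ImF x : cvg ((fun phi : l2 R X => complex.Im (phi x)) @ F).
  apply: cvg_coord => // phi psi; apply: (le_trans _ (normc_le_rnorm _ x)).
  apply: (le_trans _ (le_Im_normc _)); rewrite l2DE l2NE.
  by case: (phi x) (psi x) => [a b] [c d].
pose u : X -> R[i] := fun x => lim ((fun phi : l2 R X => complex.Re (phi x)) @ F) +i*
            lim ((fun phi : l2 R X => complex.Im (phi x)) @ F).
have le_u phi (e : R) : 0 < e -> F [set psi | rnorm (phi - psi) < e] ->
    (sqnorm ((phi : X -> R[i]) - u)%R <= (e ^+ 2)%:E)%E.
  move=> e0 Fe; apply/sqnorm_leP => s us.
  pose d (z : R[i]) (a b : R) : R :=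
    (complex.Re z - a) ^+ 2 + (complex.Im z - b) ^+ 2.
  have dE z a b : normc (z - (a +i* b)) ^+ 2 = d z a b.
    by case: z => z1 z2; rewrite /= sqr_sqrtr// addr_ge0 ?sqr_ge0.
  pose G psi := \sum_(x <- s) d (phi x) (complex.Re (psi x)) (complex.Im (psi x)).
  have GF : G @ F --> \sum_(x <- s) normc (((phi : X -> R[i]) - u) x) ^+ 2.
    rewrite /G; elim: s {us G} => [|x s IHs].
      under eq_fun do rewrite big_nil.
      by rewrite big_nil; exact: cvg_cst.
    under eq_fun do rewrite big_cons.
    rewrite big_cons; apply: cvgD => //.
    rewrite fctE opprfctE dE /d; apply: cvgD; rewrite expr2;
      under eq_fun do rewrite expr2.
      by apply: cvgM; apply: cvgB; [exact: cvg_cst|exact: ReF|exact: cvg_cst|exact: ReF].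
    by apply: cvgM; apply: cvgB; [exact: cvg_cst|exact: ImF|exact: cvg_cst|exact: ImF].
  apply: (cvgr_to_le GF); move: Fe; apply: filterS => psi /= /ltW le_e.
  have -> : G psi = \sum_(x <- s) normc ((phi - psi) x) ^+ 2.
    by apply: eq_bigr => x _; rewrite -dE l2DE l2NE; case: (psi x).
  apply: le_trans (rnorm_ge_seq _ us) _.
  by rewrite ler_pXn2r// nnegrE ?rnorm_ge0// ltW.
have uP : u \in square_summable.
  have [|phi] := cF (1 : R)%:C; first by rewrite ltcR.
  rewrite (_ : ball _ _ = [set psi | rnorm (phi - psi) < 1]); last first.
    by apply/funext => psi; rewrite l2_ballE.
  move=> /(le_u _ _ ltr01) phiu.
  have -> : u = (phi : X -> R[i]) - ((phi : X -> R[i]) - u) by rewrite opprB addrC subrK.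
  apply: rpredB; first exact: l2_square_summable.
  by rewrite inE; apply: le_lt_trans phiu _; rewrite ltry.
apply/cvg_ex; exists (L2 uP); apply/cvgrPdist_le => -[e e'].
rewrite ltcE/= => /andP[/eqP-> e0].
have e20 : 0 < e / 2 by rewrite divr_gt0.
have [|phi] := cF (e / 2)%:C; first by rewrite ltcR.
rewrite (_ : ball _ _ = [set psi | rnorm (phi - psi) < e / 2]); last first.
  by apply/funext => psi; rewrite l2_ballE.
move=> Fphi; move: (Fphi); apply: filterS => psi /= lt_e.
rewrite l2_normE lecR.
have -> : L2 uP - psi = (phi - psi) - (phi - L2 uP).
  by rewrite opprB [RHS]addrC addrA subrK.
apply: le_trans (ler_rnormD _ _) _; rewrite [leRHS]splitr lerD//; first exact: ltW.
rewrite -scaleN1r rnormZ normcN normc1 mul1r.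
by apply/rnorm_leP; [exact: ltW | exact: le_u].
Qed.

End L2Complete.

HB.instance Definition _ (R : realType) (X : Type) :=
  Uniform_isComplete.Build (l2 R X) (@l2_complete R X).

Section L2Dot.
Context {R : realType} {X : Type}.
Implicit Types phi psi : l2 R X.

(* <psi | phi>, see the convention in [hilbert] below *)
Definition l2_dot phi psi : R[i] :=
  usum (fun x : {classic X} => phi x * (psi x)^*).

Lemma usummable_dot phi psi :
  usummable (fun x : {classic X} => phi x * (psi x)^*).
Proof.
apply: (@usummable_le _ _ _
  (fun x : {classic X} => normc (phi x) ^+ 2 + normc (psi x) ^+ 2)).
  move=> x; have normcJ (z : R[i]) : normc z^* = normc z.
    by case: z => a b /=; rewrite sqrrN.
  rewrite normcM normcJ; have := sqr_ge0 (normc (phi x) - normc (psi x)).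
  have := normc_ge0 (phi x); have := normc_ge0 (psi x); nra.
under eq_esum do rewrite EFinD.
rewrite esumD; [|by move=> x _; rewrite lee_fin sqr_ge0..].
by rewrite lte_add_pinfty// -/(sqnorm _) sqr_rnormE ltry.
Qed.

Lemma l2_dotC phi psi : l2_dot phi psi = Num.conj (l2_dot psi phi).
Proof.
rewrite /l2_dot -usum_conj; last exact: usummable_dot.
congr usum; apply/funext => x; rewrite rmorphM mulrC; congr (_ * _).
by rewrite [RHS]conjCK.
Qed.

Lemma l2_dot_linearl psi : linear_for *%R (l2_dot^~ psi).
Proof.
move=> k phi phi'; rewrite /l2_dot -usum_linear; try exact: usummable_dot.
by congr usum; apply/funext => x; rewrite l2DE l2ZE mulrDl mulrA.
Qed.

Lemma l2_dot_linearr phi : linear_for (Num.conj \; *%R) (l2_dot phi).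
Proof.
move=> k psi psi'; rewrite l2_dotC l2_dot_linearl rmorphD rmorphM/=.
by rewrite -!l2_dotC.
Qed.

Lemma l2_dot_bilinear : bilinear_for ( *%R : R[i] -> R[i] -> R[i])
  (Num.conj \; *%R) l2_dot.
Proof. by split; [exact: l2_dot_linearl|exact: l2_dot_linearr]. Qed.

Lemma l2_dotE phi : l2_dot phi phi = `|phi| ^+ 2.
Proof.
rewrite /l2_dot l2_normE.
have -> : (rnorm phi)%:C ^+ 2 = (fine (sqnorm phi))%:C :> R[i].
  by rewrite sqr_rnormE rmorphXn.
rewrite -usum_realC; last 2 first.
- by move=> x; exact: sqr_ge0.
- by rewrite -/(sqnorm _) sqr_rnormE ltry.
congr usum; apply/funext => x.
by rewrite -sqr_normc norm_normc -rmorphXn.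
Qed.

Lemma l2_dot_gt0 phi : phi != 0 -> 0 < l2_dot phi phi.
Proof. by move=> phi0; rewrite l2_dotE exprn_gt0 ?normr_gt0. Qed.

HB.instance Definition _ := @bilinear_isBilinear.Build R[i] (l2 R X) (l2 R X)
  R[i] ( *%R) (Num.conj \; *%R) l2_dot l2_dot_bilinear.
HB.instance Definition _ := @isHermitianSesquilinear.Build R[i] (l2 R X)
  false Num.conj l2_dot (fun phi psi => etrans (l2_dotC phi psi) (esym (mul1r _))).
HB.instance Definition _ := @isDotProduct.Build R[i] (l2 R X) l2_dot l2_dot_gt0.
End L2Dot.

Record category := Category {
  obj :> Type ;
  mor : obj -> obj -> Type ;
  idmor : forall a, mor a a ;
  compm : forall a b c, mor b c -> mor a b -> mor a c ;
  compm1 : forall a b (f : mor a b), compm f (idmor a) = f ;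
  comp1m : forall a b (f : mor a b), compm (idmor b) f = f ;
  compmA : forall a b c d (h : mor c d) (g : mor b c) (f : mor a b),
    compm h (compm g f) = compm (compm h g) f }.

Arguments idmor {_} _.
Arguments compm {_ _ _ _} _ _.

Record functor (C D : category) := Functor {
  fobj :> C -> D ;
  fmor : forall a b : C, mor a b -> mor (fobj a) (fobj b) ;
  fmor1 : forall a : C, fmor (idmor a) = idmor (fobj a) ;
  fmorM : forall (a b c : C) (g : mor b c) (f : mor a b),
    fmor (compm g f) = compm (fmor g) (fmor f) }.

Arguments fmor {_ _} _ {_ _} _.

(* F is left adjoint to G: there are bijections mor (F c) d ~ mor c (G d),
   natural in c and d *)
Definition adjoint (C D : category) (F : functor C D) (G : functor D C) : Prop :=
  exists phi : forall (c : C) (d : D), mor (F c) d -> mor c (G d),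
  [/\ forall c d, bijective (phi c d),
      forall c c' d (h : mor c' c) (f : mor (F c) d),
        phi c' d (compm f (fmor F h)) = compm (phi c d f) h
    & forall c d d' (k : mor d d') (f : mor (F c) d),
        phi c d' (compm k f) = compm (fmor G k) (phi c d f)].

Definition has_left_adjoint (C D : category) (G : functor D C) : Prop :=
  exists F : functor C D, adjoint F G.

Definition has_right_adjoint (C D : category) (F : functor C D) : Prop :=
  exists G : functor D C, adjoint F G.

Record partial_injection (X Y : Type) := PartialInjection {
  graph :> X -> Y -> Prop ;
  graph_functional : forall x y y', graph x y -> graph x y' -> y = y' ;
  graph_injective : forall x x' y, graph x y -> graph x' y -> x = x' }.

Lemma partial_injectionP X Y (f g : partial_injection X Y) :
  (forall x y, f x y <-> g x y) -> f = g.
Proof.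
move: f g => [f f1 f2] [g g1 g2] /= fg.
have {}fg : f = g by apply/funext => x; apply/funext => y; exact/propext.
by subst g; congr PartialInjection; exact: Prop_irrelevance.
Qed.

Definition pinj_id X : partial_injection X X :=
  @PartialInjection X X eq
    (fun x y y' xy xy' => etrans (esym xy) xy')
    (fun x x' y xy x'y => etrans xy (esym x'y)).

Section PInjComp.
Context {X Y Z : Type} (g : partial_injection Y Z) (f : partial_injection X Y).

Definition comp_graph (x : X) (z : Z) : Prop := exists2 y, f x y & g y z.

Lemma comp_graph_functional x z z' :
  comp_graph x z -> comp_graph x z' -> z = z'.
Proof.
move=> [y xy yz] [y' xy' y'z']; move: yz.
by rewrite (graph_functional xy xy') => yz; exact: graph_functional yz y'z'.
Qed.

Lemma comp_graph_injective x x' z :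
  comp_graph x z -> comp_graph x' z -> x = x'.
Proof.
move=> [y xy yz] [y' xy' y'z]; move: xy.
by rewrite (graph_injective yz y'z) => xy; exact: graph_injective xy xy'.
Qed.

Definition pinj_comp : partial_injection X Z :=
  PartialInjection comp_graph_functional comp_graph_injective.

End PInjComp.

Lemma pinj_compm1 X Y (f : partial_injection X Y) : pinj_comp f (pinj_id X) = f.
Proof.
apply: partial_injectionP => x y; split=> [[_ <-]//|xy].
by exists x.
Qed.

Lemma pinj_comp1m X Y (f : partial_injection X Y) : pinj_comp (pinj_id Y) f = f.
Proof.
apply: partial_injectionP => x y; split=> [[y' xy' <-]//|xy].
by exists y.
Qed.

Lemma pinj_compmA W X Y Z (h : partial_injection Y Z) (g : partial_injection X Y)
    (f : partial_injection W X) :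
  pinj_comp h (pinj_comp g f) = pinj_comp (pinj_comp h g) f.
Proof.
apply: partial_injectionP => w z; split.
- by move=> [y [x wx xy] yz]; exists x => //; exists y.
- by move=> [x wx [y xy yz]]; exists y => //; exists x.
Qed.

Definition PInj : category :=
  Category pinj_compm1 pinj_comp1m pinj_compmA.

(* As in sesquilinear.v, [inner] is linear in its first argument and
   conjugate-linear in the second one; the inner product <u | v> that is
   conjugate-linear in u is thus [inner v u]. Completeness and the topology
   are those of the norm, which [inner_norm] ties to the inner product. *)
Record hilbert (R : realType) := Hilbert {
  hilbert_carrier :> completeNormedModType R[i] ;
  inner : {dot hilbert_carrier for Num.conj} ;
  inner_norm : forall u, inner u u = `|u| ^+ 2 }.

Record bounded_linear (R : realType) (H K : hilbert R) := BoundedLinear {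
  blin_fun :> H -> K ;
  blin_linear : linear blin_fun ;
  blin_continuous : continuous blin_fun }.

Section Hilb.
Context {R : realType}.
Implicit Types H K L : hilbert R.

Lemma bounded_linearP H K (f g : bounded_linear H K) : f =1 g -> f = g.
Proof.
move: f g => [f f1 f2] [g g1 g2] /= fg; have {}fg : f = g by exact/funext.
by subst g; congr BoundedLinear; exact: Prop_irrelevance.
Qed.

Definition blin_id H : bounded_linear H H :=
  @BoundedLinear R H H idfun (fun _ _ _ => erefl) (fun x => cvg_id).

Section BlinComp.
Context {H K L : hilbert R} (g : bounded_linear K L) (f : bounded_linear H K).

Lemma blin_comp_linear : linear (g \o f).
Proof. by move=> a u v /=; rewrite !blin_linear. Qed.

Lemma blin_comp_continuous : continuous (g \o f).
Proof. by move=> u; apply: continuous_comp; exact: blin_continuous. Qed.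

Definition blin_comp : bounded_linear H L :=
  BoundedLinear blin_comp_linear blin_comp_continuous.

End BlinComp.

Lemma blin_compm1 H K (f : bounded_linear H K) : blin_comp f (blin_id H) = f.
Proof. exact: bounded_linearP. Qed.

Lemma blin_comp1m H K (f : bounded_linear H K) : blin_comp (blin_id K) f = f.
Proof. exact: bounded_linearP. Qed.

Lemma blin_compmA H K L M (h : bounded_linear L M) (g : bounded_linear K L)
    (f : bounded_linear H K) :
  blin_comp h (blin_comp g f) = blin_comp (blin_comp h g) f.
Proof. exact: bounded_linearP. Qed.

End Hilb.

Definition Hilb (R : realType) : category :=
  Category (@blin_compm1 R) (@blin_comp1m R) (@blin_compmA R).

Definition l2_hilbert (R : realType) (X : Type) : hilbert R :=
  @Hilbert R (l2 R X) l2_dot l2_dotE.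

Section L2Functor.
Context {R : realType}.

Section Push.
Context {X Y : Type} (f : partial_injection X Y).

Definition push (phi : X -> R[i]) (y : Y) : R[i] :=
  if pselect (exists x, f x y) is left e then phi (projT1 (cid e)) else 0.

Lemma push_some phi x y : f x y -> push phi y = phi x.
Proof.
move=> xy; rewrite /push; case: pselect => [e|[]]; last by exists x.
by congr phi; apply: graph_injective xy; exact: projT2 (cid e).
Qed.

Lemma push_none phi y : (forall x, ~ f x y) -> push phi y = 0.
Proof. by move=> nxy; rewrite /push; case: pselect => // -[x xy]; case: (nxy x). Qed.

Lemma push_cases y : (exists x, f x y) \/ (forall x, ~ f x y).
Proof.
have [e|ne] := pselect (exists x, f x y); [by left|right=> x xy].
by apply: ne; exists x.
Qed.

Lemma sqnorm_push phi : (sqnorm (push phi) <= sqnorm phi)%E.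
Proof.
have [phioo|] := boolP (sqnorm phi < +oo)%E; last first.
  by rewrite -leNgt leye_eq => /eqP ->; rewrite leey.
have phifin : sqnorm phi \is a fin_num by rewrite ge0_fin_numE ?sqnorm_ge0.
rewrite -[leRHS](fineK phifin); apply/sqnorm_leP => s us.
pose pinv (y : {classic Y}) : option {classic X} :=
  if pselect (exists x, f x y) is left e then Some (projT1 (cid e)) else None.
have pinvP y x : pinv y = Some x -> f x y.
  by rewrite /pinv; case: pselect => // e [<-]; exact: projT2 (cid e).
pose h (x : {classic X}) := normc (phi x) ^+ 2.
have -> : \sum_(y <- s) normc (push phi y) ^+ 2 = \sum_(x <- pmap pinv s) h x.
  rewrite big_pmap; apply: eq_bigr => y _.
  by rewrite /push /pinv; case: pselect => [e|_] //; rewrite normc0 expr0n.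
have [+ _] := sqnorm_leP phi (fine (sqnorm phi)).
apply; first by rewrite fineK.
elim: s us => //= y s IHs /andP[ys us]; case e: (pinv y) => [x|] /=; last exact: IHs.
rewrite IHs// andbT mem_pmap; apply/mapP => -[y' y's ey'].
have xy' := pinvP _ _ (esym ey').
by move: ys; rewrite (graph_functional (pinvP _ _ e) xy') y's.
Qed.

Lemma push_square_summable (phi : l2 R X) : push phi \in square_summable.
Proof.
rewrite inE; apply: le_lt_trans (sqnorm_push _) _.
by have := l2_square_summable phi; rewrite inE.
Qed.

Definition l2_push (phi : l2 R X) : l2 R Y := L2 (push_square_summable phi).

Lemma l2_push_linear : linear l2_push.
Proof.
move=> k phi psi; apply: l2P => y; rewrite l2DE l2ZE /=.
have [[x xy]|nxy] := push_cases y; first by rewrite !(push_some _ xy).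
by rewrite !push_none// mulr0 addr0.
Qed.

Lemma l2_push_continuous : continuous l2_push.
Proof.
move=> phi; apply/(@cvgrPdist_le R[i] (l2 R Y) _ _ (nbhs_filter phi)) => e e0.
have := nbhsx_ballx phi e e0; apply: filterS => psi.
rewrite -ball_normE /ball_/= => /ltW; apply: le_trans.
have -> : l2_push phi - l2_push psi = l2_push (phi - psi).
  by rewrite -scaleN1r addrC -l2_push_linear scaleN1r addrC.
rewrite !l2_normE lecR; apply/rnorm_leP; first exact: rnorm_ge0.
by apply: le_trans (sqnorm_push _) _; rewrite sqr_rnormE.
Qed.

Definition l2_map : bounded_linear (l2_hilbert R X) (l2_hilbert R Y) :=
  @BoundedLinear R (l2_hilbert R X) (l2_hilbert R Y) l2_push
    l2_push_linear l2_push_continuous.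
End Push.

Lemma l2_map1 (X : Type) : l2_map (pinj_id X) = blin_id (l2_hilbert R X).
Proof.
by apply: bounded_linearP => phi; apply: l2P => x; exact: push_some.
Qed.

Lemma l2_mapM (X Y Z : Type) (g : partial_injection Y Z)
    (f : partial_injection X Y) :
  l2_map (pinj_comp g f) = blin_comp (l2_map g) (l2_map f).
Proof.
apply: bounded_linearP => phi; apply: l2P => z /=.
have [[y yz]|nyz] := push_cases g z.
  rewrite (push_some _ yz) /=.
  have [[x xy]|nxy] := push_cases f y.
    by rewrite (push_some _ xy); apply: push_some; exists y.
  rewrite (push_none _ nxy); apply: push_none => x [y' xy' y'z].
  by apply: (nxy x); rewrite (graph_injective yz y'z).
rewrite (push_none _ nyz); apply: push_none => x [y' _ y'z].
exact: nyz y'z.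
Qed.

End L2Functor.

Definition ell2 (R : realType) : functor PInj (Hilb R) :=
  @Functor PInj (Hilb R) (l2_hilbert R) (fun X Y => @l2_map R X Y)
    (@l2_map1 R) (@l2_mapM R).

(* Main.v *)
Require Import Defs.
From mathcomp Require Import all_boot all_order all_algebra.
From mathcomp Require Import all_classical.
From mathcomp Require Import reals.
From mathcomp Require Import ereal topology normedtype complex.

(** The hom-sets of [Hilb R] carry an addition, while an injection cannot send
    two points to one. Write [1] for a one-point set and [2] for a two-point
    set, with inclusions [pinj_in b : 1 -> 2] and their relational converses
    [pinj_out b : 2 -> 1]. In [PInj], a morphism [g] out of [2] with
    [g . pinj_in true = g . pinj_in false] satisfies [g . pinj_in b = empty],
    since a common value would violate injectivity; dually for [pinj_out] by
    functionality ([pinj_equalize_in], [pinj_equalize_out]). In [Hilb R] the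
    codiagonal [l2 2 -> l2 1], that is, the sum of the two [ell2 (pinj_out b)],
    restricts to the identity along both [ell2 (pinj_in b)].

    If [ell2] had a right adjoint [G], transposing the codiagonal would give a
    [g : 2 -> G (l2 1)] with equal restrictions, hence empty ones, equal to the
    restriction of [g] along the empty map [1 -> 2]. Transposing back, which is
    injective and natural, the identity of [l2 1] would be the restriction of
    the codiagonal along [ell2 empty = 0]; but [l2 1] is not zero. The argument
    against a left adjoint is its mirror image, with the diagonal
    [l2 1 -> l2 2], the sum of the two [ell2 (pinj_in b)]. *)

Set Implicit Arguments.
Unset Strict Implicit.
Unset Printing Implicit Defensive.
Import Order.TTheory GRing.Theory Num.Theory.
Import numFieldNormedType.Exports ComplexField.Normc.
Local Open Scope ring_scope.

Definition pinj_empty (X Y : Type) : partial_injection X Y :=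
  @PartialInjection X Y (fun _ _ => False)
    (fun _ _ _ (e : False) _ => match e with end)
    (fun _ _ _ (e : False) _ => match e with end).

Lemma unit_all_equal (u v : unit) : u = v.
Proof. by case: u v => -[]. Qed.

Definition pinj_in (b : bool) : partial_injection unit bool :=
  @PartialInjection unit bool (fun _ x => x = b)
    (fun _ _ _ e e' => etrans e (esym e'))
    (fun u v _ _ _ => unit_all_equal u v).

Definition pinj_out (b : bool) : partial_injection bool unit :=
  @PartialInjection bool unit (fun x _ => x = b)
    (fun _ u v _ _ => unit_all_equal u v)
    (fun _ _ _ e e' => etrans e (esym e')).

Lemma pinj_out_in (b c : bool) :
  pinj_comp (pinj_out c) (pinj_in b) =
  if b == c then pinj_id unit else pinj_empty unit unit.
Proof.
apply: partial_injectionP => -[] []; case: eqVneq => [->|bc] /=.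
  by split=> // _; exists c.
by split=> // -[x -> /eqP]; rewrite (negPf bc).
Qed.

(** A value [y] of both restrictions would be attained by [g] at [true] and at
    [false], against injectivity; so nothing is defined. *)
Lemma pinj_equalize_in (Y : Type) (g : partial_injection bool Y) :
  pinj_comp g (pinj_in true) = pinj_comp g (pinj_in false) ->
  pinj_comp g (pinj_in true) = pinj_comp g (pinj_empty unit bool).
Proof.
move=> e; apply: partial_injectionP => u y; split=> [gt|[] //].
have gf : pinj_comp g (pinj_in false) u y by rewrite -e.
case: gt gf => [_ -> gt] [_ -> gf].
by have := graph_injective gt gf.
Qed.

(** Under the hypothesis a point where [g] is defined would be sent both to
    [true] and to [false], against functionality. *)
Lemma pinj_equalize_out (X : Type) (g : partial_injection X bool) :
  pinj_comp (pinj_out true) g = pinj_comp (pinj_out false) g ->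
  pinj_comp (pinj_out true) g = pinj_comp (pinj_empty bool unit) g.
Proof.
move=> e; apply: partial_injectionP => x u; split=> [gt|[] //].
have gf : pinj_comp (pinj_out false) g x u by rewrite -e.
case: gt gf => [b gt /= b1] [c gf /= c0].
by have := graph_functional gt gf; rewrite b1 c0.
Qed.

Section HilbertSums.
Context {R : realType}.

Section Add.
Context {H K : hilbert R} (f g : bounded_linear H K).

Lemma blin_add_linear : linear (fun u => f u + g u).
Proof. by move=> a u v; rewrite !blin_linear scalerDr addrACA. Qed.

Lemma blin_add_continuous : continuous (fun u => f u + g u).
Proof. by move=> u; apply: cvgD; exact: blin_continuous. Qed.

Definition blin_add : bounded_linear H K :=
  BoundedLinear blin_add_linear blin_add_continuous.

End Add.

Lemma blinD (H K : hilbert R) (f : bounded_linear H K) (u v : H) :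
  f (u + v) = f u + f v.
Proof. by rewrite -[u]scale1r blin_linear !scale1r. Qed.

Lemma blin0 (H K : hilbert R) (f : bounded_linear H K) : f 0 = 0.
Proof. by apply: (addIr (f 0)); rewrite add0r -blinD addr0. Qed.

Lemma l2_map_empty (X Y : Type) (phi : l2 R X) :
  l2_map (pinj_empty X Y) phi = 0.
Proof. by apply: l2P => y; apply: push_none => x []. Qed.

Lemma l2_map_comp (X Y Z : Type) (g : partial_injection Y Z)
    (f : partial_injection X Y) (phi : l2 R X) :
  l2_map g (l2_map f phi) = l2_map (pinj_comp g f) phi.
Proof. by rewrite l2_mapM. Qed.

Lemma l2_map_out_in (b c : bool) (phi : l2 R unit) :
  l2_map (pinj_out c) (l2_map (pinj_in b) phi) = if b == c then phi else 0.
Proof.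
rewrite l2_map_comp pinj_out_in.
case: eqP => _; last exact: l2_map_empty.
by rewrite l2_map1.
Qed.

Definition codiagonal :
    bounded_linear (l2_hilbert R bool) (l2_hilbert R unit) :=
  blin_add (l2_map (pinj_out true)) (l2_map (pinj_out false)).

Definition diagonal :
    bounded_linear (l2_hilbert R unit) (l2_hilbert R bool) :=
  blin_add (l2_map (pinj_in true)) (l2_map (pinj_in false)).

(** In the sum, one summand is [ell2] of the identity and the other one is
    [ell2] of the empty map, which is zero. The codiagonal therefore does what
    [pinj_equalize_in] forbids in [PInj]: it agrees on the two inclusions
    without vanishing on them. *)
Lemma codiagonal_in (b : bool) :
  blin_comp codiagonal (l2_map (pinj_in b)) = blin_id (l2_hilbert R unit).
Proof.
apply: bounded_linearP => phi /=.
by rewrite [LHS](congr2 +%R (l2_map_out_in _ _ _) (l2_map_out_in _ _ _));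
  case: b; rewrite /= ?addr0 ?add0r.
Qed.

Lemma out_diagonal (b : bool) :
  blin_comp (l2_map (pinj_out b)) diagonal = blin_id (l2_hilbert R unit).
Proof.
apply: bounded_linearP => phi; rewrite [LHS]blinD.
by rewrite [LHS](congr2 +%R (l2_map_out_in _ _ _) (l2_map_out_in _ _ _));
  case: b; rewrite /= ?addr0 ?add0r.
Qed.

Lemma one_square_summable :
  (fun _ : unit => 1 : R[i]) \in square_summable.
Proof.
rewrite inE; apply: (@le_lt_trans _ _ 1%:E); last exact: ltry.
(* A duplicate-free list over a one-point type has at most one entry. *)
apply/sqnorm_leP => -[|[] [|[] s]]; first by rewrite big_nil.
  by rewrite big_seq1 normc1 expr1n.
by rewrite cons_uniq mem_head.
Qed.

Lemma blin_id_l2_unit_neq0 :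
  ~ (forall phi : l2 R unit, blin_id (l2_hilbert R unit) phi = 0).
Proof.
move=> /(_ (L2 one_square_summable))/(congr1 (fun phi : l2 R unit => phi tt)).
by move/eqP; rewrite /= oner_eq0.
Qed.

End HilbertSums.

Lemma ell2_no_right_adjoint (R : realType) : ~ has_right_adjoint (ell2 R).
Proof.
move=> [G [t [tbij tnat _]]].
(* Naturality at [ell2 h]: transposition commutes with restriction along [h]. *)
have restr (h : partial_injection unit bool) :
    t unit (l2_hilbert R unit) (blin_comp codiagonal (l2_map h)) =
    pinj_comp (t bool (l2_hilbert R unit) codiagonal) h := tnat _ _ _ h _.
have /pinj_equalize_in e :
    pinj_comp (t bool (l2_hilbert R unit) codiagonal) (pinj_in true) =
    pinj_comp (t bool (l2_hilbert R unit) codiagonal) (pinj_in false).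
  by rewrite -!restr !codiagonal_in.
rewrite -!restr codiagonal_in in e.
move/(bij_inj (tbij _ _)): e => e; apply: (@blin_id_l2_unit_neq0 R) => phi.
rewrite e; exact: etrans (congr1 codiagonal (l2_map_empty _ phi)) (blin0 _).
Qed.

Lemma ell2_no_left_adjoint (R : realType) : ~ has_left_adjoint (ell2 R).
Proof.
move=> [F [t [tbij _ tnat]]].
have [s ts st] := tbij (l2_hilbert R unit) bool.
pose g : partial_injection (F (l2_hilbert R unit)) bool := s diagonal.
(* Naturality in the target, read at the preimage [g] of the diagonal. *)
have corestr (k : partial_injection bool unit) :
    t (l2_hilbert R unit) unit (pinj_comp k g) =
    blin_comp (l2_map k) diagonal.
  by rewrite -[in RHS](st diagonal); exact: tnat.
have /pinj_equalize_out/(congr1 (t _ _)) :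
    pinj_comp (pinj_out true) g = pinj_comp (pinj_out false) g.
  by apply: (bij_inj (tbij _ unit)); rewrite !corestr !out_diagonal.
rewrite !corestr out_diagonal => e; apply: (@blin_id_l2_unit_neq0 R) => phi.
by rewrite e; exact: l2_map_empty.
Qed.

Theorem corollary4p8 (R : realType) :
  ~ has_left_adjoint (ell2 R) /\ ~ has_right_adjoint (ell2 R).
Proof. by split; [exact: ell2_no_left_adjoint | exact: ell2_no_right_adjoint]. Qed.
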